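(* Let $N\ge1$, let $\beta_1,\dots,\beta_N\in[0,1]$, and consider the aggregation rule FedGP, $$\widehat g_{\mathrm{FedGP}}(\theta)=\frac1N\sum_{i=1}^N\left((1-\beta_i)\,g_{\widehat{\mathcal D}_T}(\theta)+\beta_i\,\mathrm{Proj}_+\big(g_{\widehat{\mathcal D}_T}(\theta)\,\big|\,g_{\mathcal D_{S_i}}(\theta)\big)\right).$$ Given the target domain dataset $\widehat{\mathcal D}_T$ and $N$ source domains $\mathcal D_{S_1},\dots,\mathcal D_{S_N}$, we have $$\Delta^2_{\mathrm{FedGP}}\le\frac1N\sum_{i=1}^N\Delta^2_{\mathrm{FedGP},S_i},$$ where $$\begin{aligned}\Delta^2_{\mathrm{FedGP},S_i}={}&(1-\beta_i)^2\,\sigma_\pi^2(\widehat{\mathcal D}_T)+\beta_i^2\,\mathbb{E}_{\theta,\widehat{\mathcal D}_T}\big[\widehat\delta_i(\theta)\,\tau_i^2(\theta)\,\|g_{\mathcal D_T}(\theta)-g_{\mathcal D_{S_i}}(\theta)\|^2\big]\\&+(2\beta_i-\beta_i^2)\,\mathbb{E}_{\theta,\widehat{\mathcal D}_T}\big[\widehat\delta_i(\theta)\,\langle g_{\widehat{\mathcal D}_T}(\theta)-g_{\mathcal D_T}(\theta),u_{\mathcal D_{S_i}}(\theta)\rangle^2\big]\\&+2\beta_i(1-\beta_i)\,\mathbb{E}_{\theta,\widehat{\mathcal D}_T}\big[\widehat\delta_i(\theta)\,\langle g_{\mathcal D_T}(\theta),u_{\mathcal D_{S_i}}(\theta)\rangle\cdot\langle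 g_{\widehat{\mathcal D}_T}(\theta)-g_{\mathcal D_T}(\theta),u_{\mathcal D_{S_i}}(\theta)\rangle\big]\\&+\beta_i^2\,\mathbb{E}_{\theta,\widehat{\mathcal D}_T}\big[(1-\widehat\delta_i(\theta))\,\|g_{\mathcal D_T}(\theta)\|^2\big].\end{aligned}$$ Here $\widehat\delta_i(\theta):=\mathbf 1\big(\langle g_{\widehat{\mathcal D}_T}(\theta),g_{\mathcal D_{S_i}}(\theta)\rangle>0\big)$ is the indicator function (equal to $1$ if the condition holds and $0$ otherwise); $\tau_i(\theta):=\dfrac{\|g_{\mathcal D_T}(\theta)\sin\rho_i(\theta)\|}{\|g_{\mathcal D_{S_i}}(\theta)-g_{\mathcal D_T}(\theta)\|}$, where $\rho_i(\theta)$ is the angle between $g_{\mathcal D_{S_i}}(\theta)$ and $g_{\mathcal D_T}(\theta)$; and $u_{\mathcal D_{S_i}}(\theta):=g_{\mathcal D_{S_i}}(\theta)/\|g_{\mathcal D_{S_i}}(\theta)\|$.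
   Context: Setting. $\mathcal Z$ is a ground set of data points, $\Theta=\mathbb{R}^m$ is the parameter space with Euclidean inner product $\langle\cdot,\cdot\rangle$ and norm $\|\cdot\|$, and $\ell:\Theta\times\mathcal Z\to\mathbb{R}_+$ is a loss, differentiable in $\theta$; $\nabla$ denotes the gradient in $\theta$. For a distribution $\mathcal D$ on $\mathcal Z$, $\ell_{\mathcal D}(\theta):=\mathbb{E}_{z\sim\mathcal D}\,\ell(\theta,z)$ and $g_{\mathcal D}(\theta):=\nabla\ell_{\mathcal D}(\theta)$; for a finite dataset $\widehat{\mathcal D}$, $\ell_{\widehat{\mathcal D}}(\theta):=\frac{1}{|\widehat{\mathcal D}|}\sum_{z\in\widehat{\mathcal D}}\ell(\theta,z)$ and $g_{\widehat{\mathcal D}}:=\nabla\ell_{\widehat{\mathcal D}}$. Given a probability measure $\pi$ on $\Theta$, $\|g\|_\pi:=\sqrt{\mathbb{E}_{\theta\sim\pi}\|g(\theta)\|^2}$ for $g:\Theta\to\Theta$, and $L^\pi:=\{g:\Theta\to\Theta\mid\|g\|_\pi<\infty\}$. All gradient functions involved are taken to lie in $L^\pi$. The source domains $\mathcal D_{S_1},\dots,\mathcal D_{S_N}$ are fixed distributions on $\mathcal Z$. The target dataset $\widehat{\mathcal D}_T=\{z_1,\dots,z_n\}$ consists of $n$ i.i.d. samples from the target domain $\mathcal D_T$; in particular $\mathbb{E}_{\widehat{\mathcal D}_T}[g_{\widehat{\mathcal D}_T}]=g_{\mathcal D_T}$. $\mathbb{E}_{\theta,\widehat{\mathcal D}_T}$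 is the expectation over $\theta\sim\pi$ and, independently, the draw of $\widehat{\mathcal D}_T$. Quantities: - Positive projection: $\mathrm{Proj}_+(a\,|\,b):=\max\{\langle a,b\rangle,0\}\,b/\|b\|^2$ for $a,b\in\mathbb{R}^m$. - Delta error: $\Delta^2_{\mathrm{FedGP}}:=\mathbb{E}_{\widehat{\mathcal D}_T}\|g_{\mathcal D_T}-\widehat g_{\mathrm{FedGP}}\|_\pi^2$. - Target domain variance: $\sigma_\pi^2(\widehat{\mathcal D}_T):=\mathbb{E}_{\widehat{\mathcal D}_T}\|g_{\mathcal D_T}-g_{\widehat{\mathcal D}_T}\|_\pi^2$, assumed finite. Degenerate cases: expressions of the form $0/0$ are read as $0$, i.e. $\mathrm{Proj}_+(a|0)=0$, $u_{\mathcal D_{S_i}}(\theta)=0$ where $g_{\mathcal D_{S_i}}(\theta)=0$, and $\tau_i(\theta)=0$ where $g_{\mathcal D_{S_i}}(\theta)=g_{\mathcal D_T}(\theta)$; if $g_{\mathcal D_{S_i}}(\theta)=0$ or $g_{\mathcal D_T}(\theta)=0$, the angle $\rho_i(\theta)$ is taken to be $0$. *)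

(* Defs.v *)
From HB Require Import structures.
From mathcomp Require Import all_boot all_order all_algebra.
From mathcomp Require Import all_classical all_reals all_analysis.

Set Implicit Arguments.
Unset Strict Implicit.
Unset Printing Implicit Defensive.

Import Order.TTheory GRing.Theory Num.Theory.
Import numFieldNormedType.Exports.

Local Open Scope classical_set_scope.
Local Open Scope ring_scope.

(* R^m is 'rV[R]_m.  The norm that MathComp-Analysis puts on it is the sup norm,
   hence the explicit Euclidean structure.  The sup norm still provides the
   topology, the differentials and the Borel sigma-algebra, none of which depend
   on the choice of a norm. *)
Notation borel_rV R m := (g_sigma_algebraType (@open 'rV[R]_m)).

Section euclidean.
Context (R : realType) (m : nat).
Implicit Types a b : 'rV[R]_m.

Definition dot a b : R := \sum_(j < m) a 0 j * b 0 j.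

Definition enorm a : R := Num.sqrt (dot a a).

(* Division by zero is zero in R, so proj_pos a 0 = 0 and unitv 0 = 0. *)
Definition proj_pos a b : 'rV[R]_m := (Num.max (dot a b) 0 / enorm b ^+ 2) *: b.

Definition unitv a : 'rV[R]_m := (enorm a)^-1 *: a.

Definition angle a b : R :=
  if (a == 0) || (b == 0) then 0 else acos (dot a b / (enorm a * enorm b)).

Definition gradient (f : 'rV[R]_m -> R) (theta : 'rV[R]_m) : 'rV[R]_m :=
  \row_(j < m) 'D_(delta_mx 0 j) f theta.

End euclidean.

Section risks.
Context (R : realType) (m : nat) (d : measure_display) (Z : measurableType d).
Variable l : 'rV[R]_m -> Z -> R.

Definition risk (D : probability Z R) (theta : 'rV[R]_m) : R :=
  fine 'E_D[l theta].

Definition emp_risk (n : nat) (z : 'I_n -> Z) (theta : 'rV[R]_m) : R :=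
  n%:R^-1 * \sum_(k < n) l theta (z k).

(* The risk is a real-valued differentiable function, so that neither fine in
   risk nor 'D_v in gradient (risk D) returns a default value. *)
Definition differentiable_risk (D : probability Z R) : Prop :=
  (forall theta, D.-integrable setT (EFin \o l theta)) /\
  (forall theta, differentiable (risk D) theta).

End risks.

Section iid.
Context (R : realType) (d dO : measure_display) (Z : measurableType d)
  (Omega : measurableType dO) (P : probability Omega R).

(* Taking J to be any set of indices yields mutual independence. *)
Definition iid_sample (D : probability Z R) (n : nat)
    (z : 'I_n -> {RV P >-> Z}) : Prop :=
  (forall (k : 'I_n) (A : set Z), measurable A -> distribution P (z k) A = D A)
  /\
  (forall (J : {set 'I_n}) (A : 'I_n -> set Z),
     (forall k, measurable (A k)) ->
     P (\bigcap_(k in [set` J]) (z k @^-1` A k)) =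
     (\prod_(k in J) P (z k @^-1` A k))%E).

End iid.

Section pi_norm.
Context (R : realType) (m : nat) (pi : probability (borel_rV R m) R).

Definition norm_pi (g : 'rV[R]_m -> 'rV[R]_m) : \bar R :=
  sqrte (\int[pi]_theta (enorm (g theta) ^+ 2)%:E)%E.

Definition L_pi (g : 'rV[R]_m -> 'rV[R]_m) : Prop :=
  measurable_fun setT (g : borel_rV R m -> borel_rV R m) /\
  (norm_pi g < +oo)%E.

End pi_norm.

Section fedgp.
Context (R : realType) (m : nat).
Implicit Types g gS : 'rV[R]_m -> 'rV[R]_m.

Definition fedgp (N : nat) (beta : 'I_N -> R) (gh : 'rV[R]_m -> 'rV[R]_m)
    (gS : 'I_N -> 'rV[R]_m -> 'rV[R]_m) (theta : 'rV[R]_m) : 'rV[R]_m :=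
  N%:R^-1 *: \sum_(i < N) ((1 - beta i) *: gh theta +
                           beta i *: proj_pos (gh theta) (gS i theta)).

Definition delta_hat g gS (theta : 'rV[R]_m) : R :=
  (0 < dot (g theta) (gS theta))%R%:R.

(* tau is 0 where gS theta = g theta, again by x / 0 = 0. *)
Definition tau g gS (theta : 'rV[R]_m) : R :=
  enorm (sin (angle (gS theta) (g theta)) *: g theta) /
  enorm (gS theta - g theta).

Context (dO : measure_display) (Omega : measurableType dO).
Variables (pi : probability (borel_rV R m) R) (P : probability Omega R).

(* In what follows a function of w : Omega is a function of the random target
   dataset.  For gest the FedGP aggregate this is the Delta error, and for gest
   the gradient of the empirical target risk it is the target domain variance. *)
Definition mean_sq_error (gT : 'rV[R]_m -> 'rV[R]_m)
    (gest : Omega -> 'rV[R]_m -> 'rV[R]_m) : \bar R :=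
  (\int[P]_w (norm_pi pi (fun theta => gT theta - gest w theta)%R) ^+ 2)%E.

Definition E_theta_data (X : 'rV[R]_m -> Omega -> R) : \bar R :=
  (\int[pi \x P]_x (X x.1 x.2)%:E)%E.

Definition delta_sq_source (b : R) (gT : 'rV[R]_m -> 'rV[R]_m)
    (gh : Omega -> 'rV[R]_m -> 'rV[R]_m) (gS : 'rV[R]_m -> 'rV[R]_m) : \bar R :=
  (((1 - b) ^+ 2)%R%:E * mean_sq_error gT gh
   + (b ^+ 2)%R%:E * E_theta_data (fun t w =>
       delta_hat (gh w) gS t * tau gT gS t ^+ 2 * enorm (gT t - gS t) ^+ 2)%R
   + (2 * b - b ^+ 2)%R%:E * E_theta_data (fun t w =>
       delta_hat (gh w) gS t * dot (gh w t - gT t) (unitv (gS t)) ^+ 2)%R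
   + (2 * b * (1 - b))%R%:E * E_theta_data (fun t w =>
       delta_hat (gh w) gS t *
       (dot (gT t) (unitv (gS t)) * dot (gh w t - gT t) (unitv (gS t))))%R
   + (b ^+ 2)%R%:E * E_theta_data (fun t w =>
       (1 - delta_hat (gh w) gS t) * enorm (gT t) ^+ 2)%R)%E.

End fedgp.

(* Main.v *)
Require Import Defs.
From HB Require Import structures.
From mathcomp Require Import all_boot all_order all_algebra.
From mathcomp Require Import all_classical all_reals all_analysis.
From mathcomp Require Import measurable_realfun ring lra.

(* By convexity of the squared norm, the error of the average is at most the
   average of the errors against each source domain.  For a single source, put
   a = g_T, h = the empirical gradient, u = the unit vector along g_S and
   P = Proj_+(h | g_S).  Expanding |(1 - beta)(a - h) + beta (a - P)|^2
   pointwise, separately for P = <h, u> u and for P = 0, gives exactly the integrand of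
   Delta^2_{FedGP,S} plus 2 beta (1 - beta) <a - h, a>, and the latter has mean
   zero because h is an unbiased estimator of a.  Integrating term by term needs
   the joint measurability of h in (theta, data): its coordinates are limits of
   difference quotients of the jointly measurable empirical risk. *)

Set Implicit Arguments.
Unset Strict Implicit.
Unset Printing Implicit Defensive.

Import Order.TTheory GRing.Theory Num.Theory.
Import numFieldNormedType.Exports.

Local Open Scope classical_set_scope.
Local Open Scope ring_scope.

(** * Euclidean geometry *)

Section euclidean_theory.
Context (R : realType) (m : nat).
Implicit Types a b c h : 'rV[R]_m.

Lemma dotC a b : dot a b = dot b a.
Proof. by apply: eq_bigr => j _; rewrite mulrC. Qed.

Lemma dotDl a b c : dot (a + b) c = dot a c + dot b c.
Proof. by rewrite -big_split; apply: eq_bigr => j _; rewrite mxE mulrDl. Qed.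

Lemma dotZl (k : R) a b : dot (k *: a) b = k * dot a b.
Proof. by rewrite mulr_sumr; apply: eq_bigr => j _; rewrite mxE mulrA. Qed.

Lemma dotNl a b : dot (- a) b = - dot a b.
Proof. by rewrite -scaleN1r dotZl mulN1r. Qed.

Lemma dotDr a b c : dot a (b + c) = dot a b + dot a c.
Proof. by rewrite dotC dotDl !(dotC _ a). Qed.

Lemma dotZr (k : R) a b : dot a (k *: b) = k * dot a b.
Proof. by rewrite dotC dotZl (dotC b). Qed.

Lemma dotNr a b : dot a (- b) = - dot a b.
Proof. by rewrite dotC dotNl (dotC b). Qed.

Lemma dot0l a : dot 0 a = 0.
Proof. by rewrite -(scale0r 0) dotZl mul0r. Qed.

Lemma dot0r a : dot a 0 = 0.
Proof. by rewrite dotC dot0l. Qed.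

Definition dotE := (dotDl, dotDr, dotZl, dotZr, dotNl, dotNr).

Lemma dot_sumr (I : finType) a (v : I -> 'rV[R]_m) :
  dot a (\sum_i v i) = \sum_i dot a (v i).
Proof.
rewrite /dot exchange_big; apply: eq_bigr => j _ /=.
by rewrite summxE mulr_sumr.
Qed.

Lemma dot_ge0 a : 0 <= dot a a.
Proof. by apply: sumr_ge0 => j _; rewrite -expr2 sqr_ge0. Qed.

(** Nonnegativity of the squares of [a + b] and [a - b]. The crude constant suffices to dominate a
    product by integrable squares. *)
Lemma norm_dot_le a b : `|dot a b| <= dot a a + dot b b.
Proof.
have Hp := dot_ge0 (a + b); have Hm := dot_ge0 (a - b).
have := dot_ge0 a; have := dot_ge0 b.
move: Hp Hm; rewrite !dotE (dotC b) ler_norml => *.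
by apply/andP; split; lra.
Qed.

Lemma dot_gt0 a : (0 < dot a a) = (a != 0).
Proof.
rewrite lt_neqAle dot_ge0 andbT eq_sym; congr (~~ _); apply/eqP/eqP => [a0|->].
  apply/rowP => j; rewrite mxE; apply/eqP; rewrite -sqrf_eq0.
  have /psumr_eq0P -/(_ a0 j isT) : forall k, true -> 0 <= a 0 k * a 0 k.
    by move=> k _; rewrite -expr2 sqr_ge0.
  by rewrite -expr2 => /eqP.
by rewrite dot0l.
Qed.

Lemma enorm_sqr a : enorm a ^+ 2 = dot a a.
Proof. by rewrite sqr_sqrtr ?dot_ge0. Qed.

Lemma enorm_gt0 a : (0 < enorm a) = (a != 0).
Proof. by rewrite sqrtr_gt0 dot_gt0. Qed.

Lemma dot_unitv b : b != 0 -> dot (unitv b) (unitv b) = 1.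
Proof.
move=> b0; rewrite !dotE -enorm_sqr mulrA -invfM -expr2 mulVf //.
by rewrite expf_neq0 // gt_eqF // enorm_gt0.
Qed.

(** Cauchy-Schwarz, from the nonnegative square of the residual of [a] after projection on [u]. At
    [b = 0] it rests on the convention [unitv 0 = 0]. *)
Lemma dot_unitv_sqr_le a b : dot a (unitv b) ^+ 2 <= dot a a.
Proof.
have [->|b0] := eqVneq b 0.
  by rewrite /unitv scaler0 dot0r expr0n dot_ge0.
move: (dot_unitv b0); move: (unitv b) => u uu.
have := dot_ge0 (a - dot a u *: u).
rewrite !dotE (dotC _ a) uu => H; rewrite -subr_ge0.
by apply: le_trans H _; rewrite le_eqVlt; apply/orP; left; apply/eqP; ring.
Qed.

Lemma dot_unitvE a b : b != 0 -> dot a b = enorm b * dot a (unitv b).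
Proof. by move=> b0; rewrite dotZr mulrA mulfV ?mul1r// gt_eqF ?enorm_gt0. Qed.

(** Replaces the positive part by the indicator that defines [delta_hat]. At [b = 0] both sides
    vanish. *)
Lemma proj_posE h b :
  proj_pos h b = ((0 < dot h b)%R%:R * dot h (unitv b)) *: unitv b.
Proof.
rewrite /proj_pos; case: ltP => [hb|hb]; last by rewrite !mul0r !scale0r.
rewrite mul1r /unitv scalerA dotZr; congr (_ *: _).
by rewrite expr2 invfM mulrA mulrC mulrA mulrC.
Qed.

(** Pythagoras: for nonzero [a] the cosine of the angle is [dot a (unitv b) / enorm a], so both
    sides are the squared length of the component of [a] orthogonal to [b]. *)
Lemma sin_angle_sqr a b : b != 0 ->
  sin (angle b a) ^+ 2 * dot a a = dot a a - dot a (unitv b) ^+ 2.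
Proof.
move=> b0; have [->|a0] := eqVneq a 0.
  by rewrite !dot0l mulr0 expr0n subr0.
rewrite /angle (negbTE b0) (negbTE a0) /= (dotC b) dot_unitvE //.
have an0 : enorm a != 0 by rewrite gt_eqF // enorm_gt0.
rewrite -mulf_div divff ?gt_eqF ?enorm_gt0 // mul1r.
set t := _ / _.
(* Cauchy-Schwarz places [t] in [-1, 1], where [acos] inverts the cosine. *)
have t1 : t ^+ 2 <= 1.
  by rewrite expr_div_n enorm_sqr ler_pdivrMr ?dot_gt0 // mul1r
    dot_unitv_sqr_le.
have /andP[tl tr] : -1 <= t <= 1.
  by rewrite -ler_norml -(@ler_pXn2r _ 2) ?nnegrE // expr1n real_normK
    ?num_real.
rewrite sin_acos ?tl // sqr_sqrtr ?subr_ge0 // mulrBl mul1r.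
by rewrite expr_div_n enorm_sqr mulrVK // unitfE gt_eqF // dot_gt0.
Qed.

(* Also valid where g_{S_i} = g_T, the case in which tau is the junk value 0:
   there the component of g_T orthogonal to g_{S_i} vanishes. *)
Lemma tau_sqr (g gS : 'rV[R]_m -> 'rV[R]_m) theta : gS theta != 0 ->
  tau g gS theta ^+ 2 * enorm (g theta - gS theta) ^+ 2 =
  dot (g theta) (g theta) - dot (g theta) (unitv (gS theta)) ^+ 2.
Proof.
move=> b0; rewrite /tau.
have [e|ne] := eqVneq (gS theta) (g theta).
  rewrite e subrr /enorm dot0l sqrtr0.
  rewrite expr0n mulr0 dotZr -enorm_sqr; apply/esym/eqP.
  by rewrite subr_eq0 (expr2 (enorm _)) mulKf // gt_eqF // enorm_gt0 -e.
rewrite -sin_angle_sqr //.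
have -> : enorm (g theta - gS theta) = enorm (gS theta - g theta).
  by rewrite -(opprB (gS theta)) /enorm dotNl dotNr opprK.
rewrite -exprMn mulfVK ?gt_eqF ?enorm_gt0 ?subr_eq0 //.
by rewrite enorm_sqr !dotE mulrA -expr2.
Qed.

Lemma fedgp_expansion (k : R) a h b :
  let d := (0 < dot h b)%R%:R in
  let v := a - ((1 - k) *: h + k *: proj_pos h b) in
  dot v v = (1 - k) ^+ 2 * dot (a - h) (a - h)
    + k ^+ 2 * (d * (dot a a - dot a (unitv b) ^+ 2))
    + (2 * k - k ^+ 2) * (d * dot (h - a) (unitv b) ^+ 2)
    + 2 * k * (1 - k) * (d * (dot a (unitv b) * dot (h - a) (unitv b)))
    + k ^+ 2 * ((1 - d) * dot a a)
    + 2 * k * (1 - k) * dot (a - h) a.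
Proof.
rewrite /= proj_posE; case: ltP => [hb|_].
  (* A positive inner product excludes [b = 0], so [u] is a genuine unit vector and the claim
     becomes polynomial in inner products. *)
  have b0 : b != 0.
    by apply: contraTneq hb => ->; rewrite dot0r ltxx.
  rewrite (_ : true%:R = 1 :> R) // mul1r.
  move: (dot_unitv b0); move: (unitv b) => u uu.
  by rewrite !dotE uu !(dotC u) (dotC h a); ring.
rewrite (_ : false%:R = 0 :> R) // !(mul0r, scale0r, scaler0).
by rewrite addr0 subr0 !dotE (dotC h a); ring.
Qed.

(** Jensen in variance form: the squared deviations of the [v i] from their mean [c] have a
    nonnegative sum. *)
Lemma dot_mean_le (N : nat) (v : 'I_N -> 'rV[R]_m) : (0 < N)%N ->
  dot (N%:R^-1 *: \sum_i v i) (N%:R^-1 *: \sum_i v i)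
  <= N%:R^-1 * \sum_i dot (v i) (v i).
Proof.
move=> N0; set c := _ *: _.
have Nn0 : N%:R != 0 :> R by rewrite pnatr_eq0 -lt0n.
have sumv : \sum_i v i = N%:R *: c by rewrite scalerA mulfV // scale1r.
clearbody c.
have : 0 <= \sum_i dot (v i - c) (v i - c).
  by apply: sumr_ge0 => i _; exact: dot_ge0.
have -> : \sum_i dot (v i - c) (v i - c) =
    \sum_i dot (v i) (v i) - N%:R * dot c c.
  rewrite (eq_bigr (fun i => dot (v i) (v i) - (2 * dot c (v i) - dot c c))).
    rewrite !sumrB -mulr_sumr -dot_sumr sumv dotZr sumr_const card_ord.
    by rewrite -mulr_natl; ring.
  by move=> i _; rewrite !dotE (dotC _ c); ring.
by rewrite subr_ge0 -ler_pdivlMl // ltr0n.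
Qed.

End euclidean_theory.

(** * Borel measurability on R^m *)

Section borel_theory.
Context (R : realType) (m : nat) (d : measure_display) (T : measurableType d).

Lemma continuous_borel_measurable (f : 'rV[R]_m -> 'rV[R]_m) :
  continuous f -> measurable_fun setT (f : borel_rV R m -> borel_rV R m).
Proof.
move=> /continuousP cf.
apply: (@measurability _ _ (borel_rV R m) (borel_rV R m) setT f
  (@open 'rV[R]_m)) => //.
by move=> _ [B oB <-]; rewrite setTI; apply: sub_sigma_algebra; exact: cf.
Qed.

Lemma measurable_coord (j : 'I_m) :
  measurable_fun setT (fun x : borel_rV R m => x 0 j).
Proof.
apply: (@measurability _ _ _ _ setT _ _ (@RGenOInfty.measurableE R)).
move=> _ [_ [a ->] <-]; rewrite setTI; apply: sub_sigma_algebra => /=.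
have /continuousP := @coord_continuous R 1 m 0 j.
by apply; exact: interval_open.
Qed.

Lemma measurable_row (f : T -> borel_rV R m) (j : 'I_m) :
  measurable_fun setT f -> measurable_fun setT (fun x => f x 0 j).
Proof. exact: measurableT_comp (measurable_coord j). Qed.

Lemma measurable_dot (f g : T -> 'rV[R]_m) :
  (forall j, measurable_fun setT (fun x => f x 0 j)) ->
  (forall j, measurable_fun setT (fun x => g x 0 j)) ->
  measurable_fun setT (fun x => dot (f x) (g x)).
Proof.
move=> mf mg; apply: measurable_sum => j.
by apply: measurable_funM; [exact: mf|exact: mg].
Qed.

Lemma measurable_unitv (f : T -> 'rV[R]_m) (j : 'I_m) :
  (forall k, measurable_fun setT (fun x => f x 0 k)) ->
  measurable_fun setT (fun x => unitv (f x) 0 j).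
Proof.
(* The inverse norm is the real power -1/2 of the squared norm, and real powers are measurable. At
   zero both conventions return 0. *)
move=> mf; under eq_fun do
  rewrite mxE -powR_inv1 ?sqrtr_ge0 // /enorm -powR12_sqrt ?dot_ge0 // -powRrM.
apply: measurable_funM; last exact: mf.
by apply: (measurableT_comp (measurable_powR _)); exact: measurable_dot.
Qed.

Lemma measurable_gradient (F : 'rV[R]_m -> T -> R) (j : 'I_m) :
  measurable_fun setT (fun p : borel_rV R m * T => F p.1 p.2) ->
  (forall w theta, differentiable (F^~ w) theta) ->
  measurable_fun setT
    (fun p : borel_rV R m * T => gradient (F^~ p.2) p.1 0 j).
Proof.
move=> mF dF; pose e : 'rV[R]_m := delta_mx 0 j.
(* The steps [harmonic k] are nonzero and tend to 0, so these quotients converge to the derivative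
   along [e]. *)
pose q k (p : borel_rV R m * T) : R :=
  (harmonic k)^-1 * (F (harmonic k *: e + p.1) p.2 - F p.1 p.2).
apply: (@measurable_fun_cvg _ _ _ _ q) => [k|[theta w] _].
  apply: measurable_funM => //; apply: measurable_funB => //.
  pose s (p : borel_rV R m * T) : borel_rV R m * T :=
    ((harmonic k *: e + p.1) : borel_rV R m, p.2).
  apply: (@measurableT_comp _ _ _ _ _ _ _ _ s mF).
  apply: measurable_fun_pair => //.
  apply: (@measurableT_comp _ _ _ _ _ _
    (fun x : borel_rV R m => (harmonic k *: e + x : borel_rV R m))) => //.
  apply: continuous_borel_measurable => x.
  exact: cvgD (cvg_cst _) cvg_id.
rewrite mxE /=; have /cvgr_dnbhsP := @diff_derivable _ _ _ _ _ e (dF w theta).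
apply; split => [k|]; first by rewrite gt_eqF // harmonic_gt0.
exact: cvg_harmonic.
Qed.

End borel_theory.

(** * Integration *)

Section integration_theory.
Context (R : realType) (d : measure_display) (T : measurableType d)
  (mu : {measure set T -> \bar R}).
Implicit Types f g : T -> R.

Lemma integrable_dominated f g : measurable_fun setT f ->
  (forall x, `|f x| <= g x) ->
  mu.-integrable setT (EFin \o g) -> mu.-integrable setT (EFin \o f).
Proof.
move=> mf fg; apply: le_integrable => //; first exact/measurable_EFinP.
by move=> x _; rewrite lee_fin (le_trans (fg x)) // ler_norm.
Qed.

Lemma integrable_scale_add (k : R) f g :
  mu.-integrable setT (EFin \o f) -> mu.-integrable setT (EFin \o g) ->
  mu.-integrable setT (EFin \o (fun x => f x + k * g x)).
Proof.
move=> intf intg.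
by have := integrableD measurableT intf (integrableZl measurableT k intg).
Qed.

Lemma integral_scale_add (k : R) f g :
  mu.-integrable setT (EFin \o f) -> mu.-integrable setT (EFin \o g) ->
  (\int[mu]_x (f x + k * g x)%:E =
   \int[mu]_x (f x)%:E + k%:E * \int[mu]_x (g x)%:E)%E.
Proof.
move=> intf intg; under eq_integral do rewrite EFinD EFinM.
by rewrite integralD ?integralZl //; exact: integrableZl.
Qed.

(* When the positive and negative parts both have infinite integral, the
   integral of f is +oo - +oo = -oo, which is not finite either. *)
Lemma integrable_fin_integral f : measurable_fun setT f ->
  (\int[mu]_x (f x)%:E)%E \is a fin_num -> mu.-integrable setT (EFin \o f).
Proof.
move=> /measurable_EFinP mf; rewrite integralE fin_numB => /andP[fp fn].
apply/integrableP; split=> //.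
rewrite -[X in integral _ _ X]/(abse \o (EFin \o f)).
rewrite fune_abse ge0_integralD //;
  [|exact: measurable_funepos|exact: measurable_funeneg].
by rewrite lte_add_pinfty // -ge0_fin_numE // integral_ge0.
Qed.

Lemma integral_probability_cst (P : probability T R) (x : \bar R) :
  (\int[P]_w x = x)%E.
Proof.
have := integral_cst P measurableT x.
by rewrite [X in (_ * X)%E]probability_setT mule1.
Qed.

End integration_theory.

(** * Error against a single source domain *)

Section source_domain.
Context (R : realType) (m : nat) (dO : measure_display)
  (Omega : measurableType dO).
Variables (pi : probability (borel_rV R m) R) (P : probability Omega R).
Variables (a : 'rV[R]_m -> 'rV[R]_m) (h : Omega -> 'rV[R]_m -> 'rV[R]_m).
Local Notation T := (borel_rV R m * Omega)%type.
Local Notation mu := (pi \x P)%E.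

Hypothesis ma : forall j, measurable_fun setT (fun x : T => a x.1 0 j).
Hypothesis mh : forall j, measurable_fun setT (fun x : T => h x.2 x.1 0 j).

Let measurable_err j :
  measurable_fun setT (fun x : T => (a x.1 - h x.2 x.1) 0 j).
Proof. by under eq_fun do rewrite !mxE; exact: measurable_funB. Qed.

(** Tonelli for a nonnegative integrand, with the data as the outer variable; squaring cancels the
    root in [norm_pi]. *)
Lemma mean_sq_errorE :
  (mean_sq_error pi P a h =
   \int[mu]_x (dot (a x.1 - h x.2 x.1) (a x.1 - h x.2 x.1))%:E)%E.
Proof.
rewrite fubini_tonelli2 //; last first.
- by move=> x; rewrite lee_fin dot_ge0.
- by apply/measurable_EFinP; exact: measurable_dot.
apply: eq_integral => w _; rewrite /norm_pi sqr_sqrte.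
  by apply: eq_integral => t _; rewrite enorm_sqr.
by apply: integral_ge0 => t _; rewrite lee_fin sqr_ge0.
Qed.

Hypothesis a_sq_int : (\int[pi]_t (dot (a t) (a t))%:E < +oo)%E.
Hypothesis variance_fin : (mean_sq_error pi P a h < +oo)%E.
Hypothesis unbiased : forall theta j,
  (\int[P]_w (h w theta 0 j)%:E = (a theta 0 j)%:E)%E.

Let sq_a (x : T) := dot (a x.1) (a x.1).
Let sq_err (x : T) := dot (a x.1 - h x.2 x.1) (a x.1 - h x.2 x.1).

Let measurable_sq_a : measurable_fun setT sq_a.
Proof. exact: measurable_dot. Qed.

Let measurable_sq_err : measurable_fun setT sq_err.
Proof. exact: measurable_dot. Qed.

Let integrable_sq_a : mu.-integrable setT (EFin \o sq_a).
Proof.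
apply/integrableP; split; first exact/measurable_EFinP.
under eq_integral do rewrite /= ger0_norm ?dot_ge0 //.
rewrite fubini_tonelli1 //; last first.
- by move=> x; rewrite lee_fin dot_ge0.
- exact/measurable_EFinP.
rewrite [ltLHS](_ : _ = (\int[pi]_t (dot (a t) (a t))%:E)%E) //.
apply: eq_integral => t _.
exact: (integral_probability_cst P (dot (a t) (a t))%:E).
Qed.

Let integrable_sq_err : mu.-integrable setT (EFin \o sq_err).
Proof.
apply/integrableP; split; first exact/measurable_EFinP.
under eq_integral do rewrite /= ger0_norm ?dot_ge0 //.
by rewrite -mean_sq_errorE.
Qed.

Let cross (x : T) := dot (a x.1 - h x.2 x.1) (a x.1).

Let integrable_cross : mu.-integrable setT (EFin \o cross).
Proof.
apply: (@integrable_dominated _ _ _ _ _ (sq_err \+ sq_a)).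
- exact: measurable_dot.
- by move=> x; exact: norm_dot_le.
- by have := integrableD measurableT integrable_sq_err integrable_sq_a.
Qed.

(** Unbiasedness gives the integral a real value, which already forces integrability. *)
Let integrable_estimate theta j :
  P.-integrable setT (fun w => (h w theta 0 j)%:E).
Proof.
apply: integrable_fin_integral; last by rewrite unbiased.
exact: measurable_fun_pair2 (mh j).
Qed.

(** Fubini with the data integrated first: at fixed theta the factor [a t] is constant, and each
    coordinate of the error has mean zero. *)
Let integral_cross : (\int[mu]_x (cross x)%:E = 0)%E.
Proof.
rewrite -integral12_prod_meas1 //; apply: integral0_eq => t _.
rewrite /fubini_F /cross /dot /=; under eq_integral do rewrite -sumEFin.
have int_a j : P.-integrable setT (fun=> (a t 0 j)%:E).
  exact: finite_measure_integrable_cst.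
have int_err j :
    P.-integrable setT (fun w => (a t 0 j)%:E - (h w t 0 j)%:E)%E.
  exact: integrableB.
under eq_integral do under eq_bigr do rewrite !mxE mulrC EFinM EFinB.
rewrite integral_sum // => [|j]; last exact: integrableZl.
apply: big1 => j _; rewrite integralZl // integralB //.
by rewrite integral_probability_cst unbiased subee ?mule0.
Qed.

(** * Terms that involve the source gradient [b] *)

Variable b : 'rV[R]_m -> 'rV[R]_m.
Hypothesis mb : forall j, measurable_fun setT (fun x : T => b x.1 0 j).

Let measurable_unit j : measurable_fun setT (fun x : T => unitv (b x.1) 0 j).
Proof. exact: measurable_unitv. Qed.

Let delta (x : T) : R := delta_hat (h x.2) b x.1.

Let measurable_delta : measurable_fun setT delta.
Proof.
rewrite (_ : delta = fun x => if 0 < dot (h x.2 x.1) (b x.1) then 1 else 0).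
  by apply: measurable_fun_ifT => //; apply: measurable_fun_ltr => //;
    exact: measurable_dot.
by apply/funext => x; rewrite /delta /delta_hat; case: ltP.
Qed.

Let delta01 x : 0 <= delta x <= 1.
Proof. by rewrite /delta /delta_hat; case: ltP; rewrite ?lexx ?ler01. Qed.

Lemma measurable_proj_pos j :
  measurable_fun setT (fun x : T => proj_pos (h x.2 x.1) (b x.1) 0 j).
Proof.
under eq_fun do rewrite proj_posE mxE.
apply: measurable_funM => //; apply: measurable_funM => //.
exact: measurable_dot.
Qed.

Let dot_au (x : T) := dot (a x.1) (unitv (b x.1)).
Let dot_eu (x : T) := dot (h x.2 x.1 - a x.1) (unitv (b x.1)).

Let measurable_dot_au : measurable_fun setT dot_au.
Proof. exact: measurable_dot. Qed.

Let measurable_dot_eu : measurable_fun setT dot_eu.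
Proof.
apply: measurable_dot => // j.
by under eq_fun do rewrite !mxE; exact: measurable_funB.
Qed.

Let dot_au_le x : dot_au x ^+ 2 <= sq_a x.
Proof. exact: dot_unitv_sqr_le. Qed.

Let dot_eu_le x : dot_eu x ^+ 2 <= sq_err x.
Proof.
by rewrite /sq_err -opprB dotNl dotNr opprK; exact: dot_unitv_sqr_le.
Qed.

(** The integrands that carry the indicator. The first stands for the [tau] term in a form free of
    angles, whose measurability is immediate; each is dominated by [sq_a], [sq_err] or their sum. *)
Let orthogonal (x : T) := delta x * (sq_a x - dot_au x ^+ 2).
Let parallel (x : T) := delta x * dot_eu x ^+ 2.
Let mixed (x : T) := delta x * (dot_au x * dot_eu x).
Let rejected (x : T) := (1 - delta x) * sq_a x.

Let integrable_orthogonal : mu.-integrable setT (EFin \o orthogonal).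
Proof.
apply: (integrable_dominated _ _ integrable_sq_a) => [|x].
  by apply: measurable_funM => //; apply: measurable_funB => //;
    exact: measurable_funX.
have /andP[d0 d1] := delta01 x; have au := dot_au_le x.
rewrite ger0_norm; last by rewrite mulr_ge0 // subr_ge0.
apply: (@le_trans _ _ (sq_a x - dot_au x ^+ 2)).
  by rewrite ler_piMl // subr_ge0.
by rewrite lerBlDr lerDl sqr_ge0.
Qed.

Let integrable_parallel : mu.-integrable setT (EFin \o parallel).
Proof.
apply: (integrable_dominated _ _ integrable_sq_err) => [|x].
  by apply: measurable_funM => //; exact: measurable_funX.
have /andP[d0 d1] := delta01 x; rewrite ger0_norm; last first.
  by rewrite mulr_ge0 // sqr_ge0.
by apply: le_trans (dot_eu_le x); rewrite ler_piMl // sqr_ge0.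
Qed.

Let integrable_mixed : mu.-integrable setT (EFin \o mixed).
Proof.
apply: (@integrable_dominated _ _ _ _ _ (sq_err \+ sq_a)) => [|x|].
- by apply: measurable_funM => //; exact: measurable_funM.
- have /andP[d0 d1] := delta01 x.
  rewrite normrM (ger0_norm d0); apply: (@le_trans _ _ `|dot_au x * dot_eu x|).
    by rewrite ler_piMl.
  (* The squares of the sum and the difference bound twice the absolute product by the sum of
     squares. *)
  have := dot_au_le x; have := dot_eu_le x.
  have := sqr_ge0 (dot_au x - dot_eu x); have := sqr_ge0 (dot_au x + dot_eu x).
  by rewrite ler_norml /= => *; apply/andP; split; nra.
- by have := integrableD measurableT integrable_sq_err integrable_sq_a.
Qed.

Let integrable_rejected : mu.-integrable setT (EFin \o rejected).
Proof.
apply: (integrable_dominated _ _ integrable_sq_a) => [|x].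
  by apply: measurable_funM => //; exact: measurable_funB.
have /andP[d0 d1] := delta01 x; rewrite ger0_norm; last first.
  by rewrite mulr_ge0 ?subr_ge0 //; exact: dot_ge0.
by rewrite ler_piMl ?lerBlDr ?lerDl //; exact: dot_ge0.
Qed.

Variable k : R.

(** The error of the rule with the single source gradient [b] and weight [k]. *)
Let v (x : T) : 'rV[R]_m :=
  a x.1 - ((1 - k) *: h x.2 x.1 + k *: proj_pos (h x.2 x.1) (b x.1)).

(* The leading 0 makes all six terms summands of the form [k * g x], as in
   integral_scale_add. *)
Let vE : (fun x => dot (v x) (v x)) =
  fun x => 0 + (1 - k) ^+ 2 * sq_err x + k ^+ 2 * orthogonal x
    + (2 * k - k ^+ 2) * parallel x + 2 * k * (1 - k) * mixed x
    + k ^+ 2 * rejected x + 2 * k * (1 - k) * cross x.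
Proof. by apply/funext => x; rewrite add0r; exact: fedgp_expansion. Qed.

Lemma measurable_source_error j : measurable_fun setT (fun x => v x 0 j).
Proof.
rewrite (_ : (fun _ => _) = fun x : T => a x.1 0 j -
    ((1 - k) * h x.2 x.1 0 j + k * proj_pos (h x.2 x.1) (b x.1) 0 j)).
  by apply: measurable_funB => //; apply: measurable_funD;
    apply: measurable_funM => //; exact: measurable_proj_pos.
by apply/funext => x; rewrite !mxE.
Qed.

Lemma integrable_source_error :
  mu.-integrable setT (EFin \o (fun x => dot (v x) (v x))).
Proof.
rewrite vE; do 6!apply: integrable_scale_add => //.
exact: integrable0.
Qed.

Lemma integral_source_error :
  (\int[mu]_x (dot (v x) (v x))%:E = delta_sq_source pi P k a h b)%E.
Proof.
have vE' x : dot (v x) (v x) = _ := congr1 (@^~ x) vE.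
under eq_integral do rewrite vE'.
have int0 : mu.-integrable setT (EFin \o (fun=> 0 : R)).
  exact: integrable0.
rewrite !integral_scale_add //; do ?by do ?apply: integrable_scale_add.
rewrite integral_cross mule0 adde0 integral0 add0e -mean_sq_errorE.
rewrite /delta_sq_source /E_theta_data.
(* The variance, parallel and mixed terms agree by unfolding; the rejected and orthogonal ones
   remain. *)
congr (_ + _ * _ + _ + _ + _ * _)%E; last first.
  by apply: eq_integral => x _; rewrite enorm_sqr.
apply: eq_integral => x _; congr EFin; rewrite /orthogonal /delta /delta_hat.
(* Where the indicator is 1, [b] is nonzero and [tau_sqr] restores the angle. *)
case: ltP => [hb|_]; last by rewrite !mul0r.
rewrite -mulrA tau_sqr //.
by apply: contraTneq hb => ->; rewrite dot0r ltxx.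
Qed.

End source_domain.

(** * Averaging over the source domains *)

Theorem theoremA5 (R : realType) (m : nat)
  (d : measure_display) (Z : measurableType d)
  (l : 'rV[R]_m -> Z -> R)
  (l_ge0 : forall theta z, 0 <= l theta z)
  (l_measurable :
     measurable_fun setT (fun p : borel_rV R m * Z => l p.1 p.2))
  (l_differentiable :
     forall z theta, differentiable (fun t => l t z) theta)
  (pi : probability (borel_rV R m) R)
  (N : nat) (N_gt0 : (0 < N)%N)
  (DS : 'I_N -> probability Z R) (DT : probability Z R)
  (DS_risk : forall i, differentiable_risk l (DS i))
  (DT_risk : differentiable_risk l DT)
  (dO : measure_display) (Omega : measurableType dO)
  (P : probability Omega R)
  (n : nat) (n_gt0 : (0 < n)%N)
  (z : 'I_n -> {RV P >-> Z}) (z_iid : iid_sample DT z)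
  (beta : 'I_N -> R) (beta01 : forall i, 0 <= beta i <= 1) :
  let gS := fun i => gradient (risk l (DS i)) in
  let gT := gradient (risk l DT) in
  let gh := fun w => gradient (emp_risk l (fun k => z k w)) in
  forall
  (gS_L : forall i, L_pi pi (gS i))
  (gT_L : L_pi pi gT)
  (gh_L : forall w, L_pi pi (gh w))
  (gh_unbiased : forall (theta : 'rV[R]_m) (j : 'I_m),
     'E_P[fun w => gh w theta 0%R j]%E = (gT theta 0 j)%:E)
  (gh_variance : (mean_sq_error pi P gT gh < +oo)%E),
  (mean_sq_error pi P gT (fun w => fedgp beta (gh w) gS) <=
   (N%:R^-1)%:E *
   \sum_(i < N) delta_sq_source pi P (beta i) gT gh (gS i))%E.
Proof.
move=> gS gT gh gS_L gT_L gh_L gh_unbiased gh_variance.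
have unbiased theta j : (\int[P]_w (gh w theta 0 j)%:E = (gT theta 0 j)%:E)%E.
  by rewrite -gh_unbiased unlock.
have m_gT j : measurable_fun setT (fun x : borel_rV R m * Omega => gT x.1 0 j).
  by apply: (measurableT_comp (measurable_row j gT_L.1)).
have m_gS i j :
    measurable_fun setT (fun x : borel_rV R m * Omega => gS i x.1 0 j).
  by apply: (measurableT_comp (measurable_row j (gS_L i).1)).
have m_gh j :
    measurable_fun setT (fun x : borel_rV R m * Omega => gh x.2 x.1 0 j).
  apply: (measurable_gradient
    (F := fun theta w => emp_risk l (fun k => z k w) theta)).
    apply: measurable_funM => //; apply: measurable_sum => k.
    pose s (x : borel_rV R m * Omega) : borel_rV R m * Z := (x.1, z k x.2).
    apply: (@measurableT_comp _ _ _ _ _ _ _ _ s l_measurable).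
    by apply: measurable_fun_pair => //; apply: measurableT_comp.
  move=> w theta; apply: differentiableM => //.
  rewrite (_ : (fun _ => _) = \sum_(k < n) (fun t => l t (z k w))).
    by apply: differentiable_sum => k; exact: l_differentiable.
  by apply/funext => t; rewrite fct_sumE.
(* From here on the gradients are abstract functions with the properties recorded above. *)
clearbody gS gT gh.
have gT_sq : (\int[pi]_t (dot (gT t) (gT t))%:E < +oo)%E.
  have [_ ] := gT_L; rewrite /norm_pi; under eq_integral do rewrite enorm_sqr.
  (* [sqrte] sends +oo to +oo, so a finite norm excludes an infinite integral. *)
  by case: (integral _ _ _) => [r||] *; rewrite ?ltry ?ltNyr.
pose v i (x : borel_rV R m * Omega) := gT x.1 -
  ((1 - beta i) *: gh x.2 x.1 + beta i *: proj_pos (gh x.2 x.1) (gS i x.1)).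
have m_v i j : measurable_fun setT (fun x => v i x 0 j).
  exact: measurable_source_error.
have vE (x : borel_rV R m * Omega) :
    gT x.1 - fedgp beta (gh x.2) gS x.1 = N%:R^-1 *: \sum_i v i x.
  (* [gT x.1] is the mean of [N] copies of itself, which uses that [N] is nonzero. *)
  rewrite /v sumrB scalerBr; congr (_ - _).
  rewrite sumr_const card_ord -(scaler_nat N (gT x.1)) scalerA mulVf.
    by rewrite scale1r.
  by rewrite pnatr_eq0 -lt0n.
have int_v i :
    (pi \x P)%E.-integrable setT (EFin \o (fun x => dot (v i x) (v i x))).
  exact: integrable_source_error.
have m_dot_v i : measurable_fun setT (fun x => dot (v i x) (v i x)).
  exact: measurable_dot.
rewrite mean_sq_errorE // => [|j]; last first.
  rewrite (_ : (fun _ => _) = fun x : borel_rV R m * Omega =>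
      gT x.1 0 j - N%:R^-1 * \sum_i v i x 0 j).
    by apply: measurable_funB => //; apply: measurable_funM => //;
      exact: measurable_sum.
  (* Writing the aggregate as [gT] minus its error reduces its measurability to that of the
     [v i]. *)
  apply/funext => x; rewrite -[fedgp _ _ _ _](subKr (gT x.1)) vE.
  by rewrite 3!mxE summxE.
under eq_integral do rewrite vE.
rewrite (eq_bigr (fun i => \int[pi \x P]_x (dot (v i x) (v i x))%:E)%E);
  last first.
  by move=> i _; apply/esym; exact: integral_source_error.
(* With the sum and the factor moved under the integral, the claim follows from the pointwise Jensen
   inequality. *)
rewrite -integral_sum // -integralZl //; last first.
  by apply: integrable_sum => // i _; exact: int_v.
apply: ge0_le_integral => //.
- by move=> x _; rewrite lee_fin dot_ge0.
- apply/measurable_EFinP; under eq_fun do rewrite dotZl dotZr.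
  apply: measurable_funM => //; apply: measurable_funM => //.
  by apply: measurable_dot => j; under eq_fun do rewrite summxE;
    exact: measurable_sum.
- under eq_fun do rewrite sumEFin; apply/measurable_EFinP.
  by apply: measurable_funM => //; exact: measurable_sum.
- by move=> x _; rewrite sumEFin -EFinM lee_fin; exact: dot_mean_le.
Qed.
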